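(* In the setting described in the context (unilateral contact of $N$ elastic bodies), suppose that: the boundaries $\Gamma_\alpha=\partial\Omega_\alpha$ are Lipschitz; $\Gamma_\alpha^u\neq\emptyset$ and $\Gamma_\alpha^u=\overline{\Gamma_\alpha^u}$; ${\bf f}_\alpha\in[L_2(\Omega_\alpha)]^3$, ${\bf p}_\alpha\in[L_2(\Gamma_\alpha^\sigma)]^3$, $C_{\alpha ijkl}\in L_\infty(\Omega_\alpha)$ for all $\alpha=1,\dots,N$, $i,j,k,l=1,2,3$; the elastic coefficients are uniformly elliptic with constants $0<b\le d<\infty$ (as written in the context); the surfaces $S_{\alpha\beta}$, $\{\alpha,\beta\}\in Q$, are Lipschitz; and $d_{\alpha\beta}\in H^{1/2}_{00}(\Xi_\alpha)$. Let $\theta>0$, let $M,B,D,Z>0$ be the constants described in the context, and let $\gamma\in(0;\gamma_2)$, $\gamma_2=2B^2/(M+D)^2$. Let $\bar{\bf u}\in V_0$ be the exact solution of the nonlinear penalty variational equation $$A(\bar{\bf u},{\bf v})+J'_\theta(\bar{\bf u},{\bf v})-L({\bf v})=0\qquad\forall\,{\bf v}\in V_0 .$$ Then the sequence $\{{\bf u}^k\}\subset V_0$ obtained, from an initial approximation ${\bf u}^0\in V_0$, by the iterative method $$A(\tilde{\bf u}^{k+1},{\bf v})+X(\tilde{\bf u}^{k+1},{\bf v})=L({\bf v})+X({\bf u}^k,{\bf v})-J'_\theta({\bf u}^k,{\bf v})\quad\forall\,{\bf v}\in V_0,$$ $${\bf u}^{k+1}=\gamma\,\tilde{\bf u}^{k+1}+(1-\gamma){\bf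 u}^k,\qquad k=0,1,\dots,$$ which is equivalent to the iterative method $G({\bf u}^{k+1},{\bf v})=G({\bf u}^k,{\bf v})-\gamma[A({\bf u}^k,{\bf v})+J'_\theta({\bf u}^k,{\bf v})-L({\bf v})]$, ${\bf v}\in V_0$, with the bilinear form $G=A+X$, converges strongly in $V_0$ to $\bar{\bf u}$, i.e. $\|{\bf u}^k-\bar{\bf u}\|_{V_0}\to0$ as $k\to\infty$. Moreover, the convergence rate in the norm $\|{\bf u}\|_G=\sqrt{G({\bf u},{\bf u})}$ is linear: $$\|{\bf u}^{k+1}-\bar{\bf u}\|_G\le q\,\|{\bf u}^k-\bar{\bf u}\|_G,\qquad q=\sqrt{1-\gamma\,(2B-\gamma M_*^2/B)/(M+Z)}<1,\qquad M_*=M+D,$$ and the maximal rate (i.e. the minimal $q$) is reached at $\gamma=\bar\gamma=B^2/M_*^2$.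
   Context: Bodies and boundaries. $\Omega_\alpha\subset\mathbb R^3$, $\alpha=1,\dots,N$, are elastic bodies with Lipschitz boundaries $\Gamma_\alpha=\partial\Omega_\alpha$ and outer unit normals ${\bf n}_\alpha$. $\Gamma_\alpha=\Gamma_\alpha^u\cup\Gamma_\alpha^\sigma\cup S_\alpha$ with $\Gamma_\alpha^u\cap\Gamma_\alpha^\sigma\cap S_\alpha=\emptyset$, $\Gamma_\alpha^u\neq\emptyset$, $\Gamma_\alpha^u=\overline{\Gamma_\alpha^u}$, $S_\alpha\neq\emptyset$. $S_\alpha=\bigcup_{\beta\in B_\alpha}S_{\alpha\beta}$, where $B_\alpha\subset\{1,\dots,N\}$ is the set of indices of all bodies in contact with $\Omega_\alpha$ and $S_{\alpha\beta}\subset\Gamma_\alpha$ is the possible contact area of $\Omega_\alpha$ with $\Omega_\beta$. $Q=\{\{\alpha,\beta\}:\alpha\in\{1,\dots,N\},\beta\in B_\alpha\}$ is the set of unordered pairs of indices of bodies in contact. Put $\Xi_\alpha=\mathrm{int}(\Gamma_\alpha\setminus\Gamma_\alpha^u)$. The surfaces $S_{\alpha\beta}$ and $S_{\beta\alpha}$ are assumed sufficiently close, so that ${\bf n}_\alpha({\bf x})\approx-{\bf n}_\beta({\bf x}')$, where ${\bf x}'=P({\bf x})\in S_{\beta\alpha}$ is the orthogonal projection of ${\bf x}\in S_{\alpha\beta}$ on $S_{\beta\alpha}$; on $S_{\alpha\beta}$ quantities of body $\beta$ are taken at ${\bf x}'$. $d_{\alpha\beta}({\bf x})=\pm\|{\bf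 x}-{\bf x}'\|_2$ is the distance between the bodies before deformation (the sign depends on the specific problem). The bodies are rigidly fixed on $\Gamma_\alpha^u$. Spaces. $V_\alpha=[H^1(\Omega_\alpha)]^3$ with scalar product $({\bf u}_\alpha,{\bf v}_\alpha)_{V_\alpha}=\sum_i\int_{\Omega_\alpha}\big(u_{\alpha i}v_{\alpha i}+\sum_j\frac{\partial u_{\alpha i}}{\partial x_j}\frac{\partial v_{\alpha i}}{\partial x_j}\big)d\Omega$; $V_\alpha^0=\{{\bf u}_\alpha\in V_\alpha: \text{trace of }{\bf u}_\alpha=0\text{ on }\Gamma_\alpha^u\}$; $V_0=V_1^0\times\dots\times V_N^0$ with $({\bf u},{\bf v})_{V_0}=\sum_\alpha({\bf u}_\alpha,{\bf v}_\alpha)_{V_\alpha}$ and the induced norm $\|\cdot\|_{V_0}$. $\mathrm{Tr}_\alpha^0:V_\alpha^0\to[H^{1/2}_{00}(\Xi_\alpha)]^3$ is the (surjective, linear, continuous) trace operator, and $u_{\alpha n}={\bf n}_\alpha\cdot\mathrm{Tr}_\alpha^0({\bf u}_\alpha)$. Elasticity. $\varepsilon_{\alpha ij}({\bf u}_\alpha)=\frac12(\partial u_{\alpha i}/\partial x_j+\partial u_{\alpha j}/\partial x_i)$, $\sigma_{\alpha ij}({\bf u}_\alpha)=\sum_{k,l}C_{\alpha ijkl}\varepsilon_{\alpha kl}({\bf u}_\alpha)$, where the coefficients $C_{\alpha ijkl}$ are measurable, symmetric and uniformly elliptic: $b\sum_{i,j}\varepsilon_{\alpha ij}^2({\bf x})\le\sum_{i,j,k,l}C_{\alpha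 ijkl}({\bf x})\varepsilon_{\alpha ij}({\bf x})\varepsilon_{\alpha kl}({\bf x})\le d\sum_{k,l}\varepsilon_{\alpha kl}^2({\bf x})$. ${\bf f}_\alpha$ are volume forces and ${\bf p}_\alpha$ are given boundary stresses on $\Gamma_\alpha^\sigma$. Define $$A({\bf u},{\bf v})=\sum_{\alpha=1}^N\int_{\Omega_\alpha}\sum_{i,j}\sigma_{\alpha ij}({\bf u}_\alpha)\varepsilon_{\alpha ij}({\bf v}_\alpha)\,d\Omega,\quad L({\bf v})=\sum_{\alpha=1}^N\Big(\int_{\Omega_\alpha}{\bf f}_\alpha\cdot{\bf v}_\alpha\,d\Omega+\int_{\Gamma_\alpha^\sigma}{\bf p}_\alpha\cdot\mathrm{Tr}_\alpha^0({\bf v}_\alpha)\,dS\Big).$$ Penalty. With $y^-=\min\{0,y\}$ and penalty parameter $\theta>0$, $$J_\theta'({\bf u},{\bf v})=-\frac1\theta\sum_{\{\alpha,\beta\}\in Q}\int_{S_{\alpha\beta}}(d_{\alpha\beta}-u_{\alpha n}-u_{\beta n})^-(v_{\alpha n}+v_{\beta n})\,dS .$$ Form $X$. For some given subareas $S_{\alpha\beta}^1\subseteq S_{\alpha\beta}$, let $\psi_{\alpha\beta}$ be the characteristic function of $S_{\alpha\beta}^1$ on $S_{\alpha\beta}$ ($\alpha=1,\dots,N$, $\beta\in B_\alpha$), and $$X({\bf u},{\bf v})=\frac1\theta\sum_{\{\alpha,\beta\}\in Q}\int_{S_{\alpha\beta}}\big(u_{\alpha n}v_{\alpha n}\psi_{\alpha\beta}+u_{\beta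 n}v_{\beta n}\psi_{\beta\alpha}\big)\,dS .$$ Constants. $M,B,D,Z>0$ denote the constants in the following bounds, valid for all ${\bf u},{\bf v},{\bf w}\in V_0$: $|A({\bf u},{\bf v})|\le M\|{\bf u}\|_{V_0}\|{\bf v}\|_{V_0}$; $A({\bf u},{\bf u})\ge B\|{\bf u}\|_{V_0}^2$; $|J'_\theta({\bf u}+{\bf w},{\bf v})-J'_\theta({\bf u},{\bf v})|\le D\|{\bf v}\|_{V_0}\|{\bf w}\|_{V_0}$; $|X({\bf u},{\bf v})|\le Z\|{\bf u}\|_{V_0}\|{\bf v}\|_{V_0}$. *)

(* Defs.v *)
From HB Require Import structures.
From mathcomp Require Import all_boot all_order all_algebra.
From mathcomp Require Import all_classical all_reals all_analysis.

Set Implicit Arguments.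
Unset Strict Implicit.
Unset Printing Implicit Defensive.
Import Order.TTheory GRing.Theory Num.Theory.
Import numFieldNormedType.Exports.
Local Open Scope classical_set_scope.
Local Open Scope ring_scope.

(* R^3 is the triple product, which carries the product topology, the product
   (= Borel) sigma-algebra and the product Lebesgue measure; the norm provided
   by the library on it is the sup norm, hence [enorm] below. *)
Notation R3 R := (R * R * R)%type.

(* [lebesgue_measure] on the carrier R itself: the library states it on the
   alias [measurableTypeR R], which has the same sigma-algebra but another
   display. *)
Definition leb1 {R : realType} (A : set R) : \bar R := @lebesgue_measure R A.

HB.instance Definition _ (R : realType) := isMeasure.Build _ R R leb1
  (@measure0 _ _ _ (@lebesgue_measure R))
  (fun A => @measure_ge0 _ _ _ (@lebesgue_measure R) A)
  (@measure_semi_sigma_additive _ _ _ (@lebesgue_measure R)).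

HB.instance Definition _ (R : realType) :=
  @Measure_isSigmaFinite.Build _ R R leb1 (@sigma_finiteT _ _ _ (@lebesgue_measure R)).

Section euclidean.
Context {R : realType}.
Implicit Types (x y : R3 R) (i j : 'I_3) (A S W : set (R3 R)).

Definition coord x i : R := [:: x.1.1; x.1.2; x.2]`_i.
Definition ebase j : R3 R := ((j == 0%N :> nat)%:R, (j == 1%N :> nat)%:R, (j == 2%N :> nat)%:R).
Definition dot x y : R := \sum_i coord x i * coord y i.
Definition enorm x : R := Num.sqrt (dot x x).

Definition vol : {measure set (R3 R) -> \bar R} :=
  ((leb1 \x leb1) \x leb1)%E.

(* Squared Euclidean diameter, 0 for the empty set. *)
Definition diam2 A : \bar R :=
  ereal_sup ([set 0%E] `|`
             [set z | exists x y, [/\ A x, A y & z = (enorm (x - y) ^+ 2)%:E]]).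

(* Two-dimensional Hausdorff (outer) measure; the factor pi / 4 makes it agree
   with surface area. *)
Definition hausdorff2_le (delta : R) A : \bar R :=
  ereal_inf [set s | exists F : nat -> set (R3 R),
    [/\ A `<=` \bigcup_k F k, (forall k, (diam2 (F k) <= (delta ^+ 2)%:E)%E)
      & s = (\sum_(k <oo) ((pi / 4)%:E * diam2 (F k)))%E]].

Definition hausdorff2 A : \bar R :=
  ereal_sup [set hausdorff2_le delta A | delta in [set delta : R | 0 < delta]].

(* Pins down the surface measure: a measure on the Borel sets is determined by
   its values there. *)
Definition is_surface_measure (dS : {measure set (R3 R) -> \bar R}) : Prop :=
  forall A, measurable A -> dS A = hausdorff2 A.

Definition boundary W : set (R3 R) := closure W `\` W°.

Definition orthonormal_frame (e : 'I_3 -> R3 R) : Prop :=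
  forall i j, dot (e i) (e j) = (i == j)%:R.

Definition frame_base (e : 'I_3 -> R3 R) y : R * R :=
  (dot (e (inord 0)) y, dot (e (inord 1)) y).
Definition frame_height (e : 'I_3 -> R3 R) y : R := dot (e (inord 2)) y.

Definition lipschitz_boundary W : Prop :=
  forall x, boundary W x ->
  exists (e : 'I_3 -> R3 R) (phi : R * R -> R) (U : set (R3 R)),
    [/\ orthonormal_frame e, lipschitz phi, nbhs x U &
        forall y, U y -> (W y <-> phi (frame_base e y) < frame_height e y)].

(* Parameter domain of a Lipschitz surface in a local chart: the plane, or (at
   an edge of the surface) a Lipschitz half-plane with or without its edge. *)
Definition lipschitz_chart_domain (P : set (R * R)) : Prop :=
  P = setT \/
  exists2 psi : R -> R, lipschitz psi &
    forall t, (psi t.1 < t.2 -> P t) /\ (P t -> psi t.1 <= t.2).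

Definition lipschitz_surface S : Prop :=
  forall x, S x ->
  exists (e : 'I_3 -> R3 R) (phi : R * R -> R) (P : set (R * R)) (U : set (R3 R)),
    [/\ orthonormal_frame e, lipschitz phi, lipschitz_chart_domain P, nbhs x U &
        forall y, U y ->
          (S y <-> P (frame_base e y) /\ frame_height e y = phi (frame_base e y))].

(* The unit vector n is the outer normal of W at x when W is, to first order at
   x, the half-space {y | n . (y - x) < 0}; at a boundary point of a Lipschitz
   domain this says that the local graph is differentiable there. *)
Definition outer_normal_at W x (n : R3 R) : Prop :=
  enorm n = 1 /\
  forall eps : R, 0 < eps -> exists2 delta : R, 0 < delta &
    forall y, enorm (y - x) < delta ->
      (dot n (y - x) < - eps * enorm (y - x) -> W y) /\
      (eps * enorm (y - x) < dot n (y - x) -> ~ closure W y).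

Definition is_outer_normal (dS : {measure set (R3 R) -> \bar R}) W
    (n : R3 R -> R3 R) : Prop :=
  measurable_fun (boundary W) n /\
  {ae dS, forall x, boundary W x -> outer_normal_at W x (n x)}.

Definition rel_interior S A : set (R3 R) :=
  [set x | A x /\ exists2 U : set (R3 R), nbhs x U & U `&` S `<=` A].

End euclidean.

Section function_spaces.
Context {R : realType}.
Implicit Types (W G E : set (R3 R)) (f g phi : R3 R -> R) (i j : 'I_3).

Definition L2 (mu : {measure set (R3 R) -> \bar R}) E f : Prop :=
  measurable_fun E f /\ (\int[mu]_(x in E) (f x ^+ 2)%:E < +oo)%E.

Definition Linfty (mu : {measure set (R3 R) -> \bar R}) E f : Prop :=
  measurable_fun E f /\
  exists K : R, {ae mu, forall x, E x -> `|f x| <= K}.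

Definition partial j phi : R3 R -> R := fun x => 'D_(ebase j) phi x.

Fixpoint Ck (k : nat) phi : Prop :=
  continuous phi /\
  if k is k'.+1 then
    forall j, (forall x, derivable phi x (ebase j)) /\ Ck k' (partial j phi)
  else True.

Definition smooth phi : Prop := forall k, Ck k phi.

Definition test_function W phi : Prop :=
  smooth phi /\
  exists K : set (R3 R), [/\ compact K, K `<=` W & forall x, ~ K x -> phi x = 0].

Definition is_weak_partial W j f g : Prop :=
  forall phi, test_function W phi ->
    \int[vol]_(x in W) (f x * partial j phi x) = - \int[vol]_(x in W) (g x * phi x).

(* A Sobolev function is carried together with its (a.e. unique) weak gradient;
   jets are an R-module for the pointwise operations.  Functions equal almost
   everywhere are not identified: norms below are seminorms on representatives. *)
Definition jet := ((R3 R -> R) * ('I_3 -> R3 R -> R))%type.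
Implicit Types u v : jet.

Definition H1 W : set jet :=
  [set u | [/\ L2 vol W u.1, (forall j, L2 vol W (u.2 j))
             & forall j, is_weak_partial W j u.1 (u.2 j)]].

Definition H1ip W u v : R :=
  \int[vol]_(x in W) (u.1 x * v.1 x + \sum_j u.2 j x * v.2 j x).

Definition smooth_jet phi : jet := (phi, fun j => partial j phi).

(* Sobolev-Slobodeckij norm on a two-dimensional surface G. *)
Definition H12_norm2 (dS : {measure set (R3 R) -> \bar R}) G g : \bar R :=
  (\int[dS]_(x in G) (g x ^+ 2)%:E +
   \int[dS]_(x in G) \int[dS]_(y in G)
     ((g x - g y) ^+ 2 / enorm (x - y) ^+ 3)%:E)%E.

Definition H12 (dS : {measure set (R3 R) -> \bar R}) G g : Prop :=
  measurable_fun G g /\ (H12_norm2 dS G g < +oo)%E.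

(* H^{1/2}_{00}(Xi), for Xi a relatively open part of G, is the space of the
   functions on Xi whose extension by zero is in H^{1/2}(G); such a function
   is identified with that extension. *)
Definition H1200 (dS : {measure set (R3 R) -> \bar R}) G E g : Prop :=
  H12 dS G g /\ {ae dS, forall x, (G `\` E) x -> g x = 0}.

(* The trace operator H^1(W) -> H^{1/2}(boundary W): on a bounded Lipschitz
   domain these properties determine T u up to dS-null sets. *)
Definition is_trace_operator (dS : {measure set (R3 R) -> \bar R}) W
    (T : jet -> R3 R -> R) : Prop :=
  [/\ (forall u, H1 W u -> H12 dS (boundary W) (T u)),
      (forall (c : R) u v, H1 W u -> H1 W v ->
         {ae dS, forall x, boundary W x -> T (c *: u + v) x = c * T u x + T v x}),
      (exists K : R, forall u, H1 W u ->
         (H12_norm2 dS (boundary W) (T u) <= (K * H1ip W u u)%:E)%E),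
      (forall g, H12 dS (boundary W) g ->
         exists2 u, H1 W u & {ae dS, forall x, boundary W x -> T u x = g x}) &
      (forall phi, smooth phi ->
         {ae dS, forall x, boundary W x -> T (smooth_jet phi) x = phi x})].

End function_spaces.
Arguments jet : clear implicits.

Record contact_problem (R : realType) (N : nat) := ContactProblem {
  body : 'I_N -> set (R3 R);                       (* Omega_a *)
  normal : 'I_N -> R3 R -> R3 R;                   (* n_a *)
  trace : 'I_N -> jet R -> R3 R -> R;              (* Tr_a, componentwise *)
  Gamma_u : 'I_N -> set (R3 R);
  Gamma_s : 'I_N -> set (R3 R);                    (* Gamma_a^sigma *)
  nbr : 'I_N -> {set 'I_N};                        (* B_a *)
  S : 'I_N -> 'I_N -> set (R3 R);                  (* S_ab *)
  proj : 'I_N -> 'I_N -> R3 R -> R3 R;             (* x |-> x', S_ab -> S_ba *)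
  gap : 'I_N -> 'I_N -> R3 R -> R;                 (* d_ab *)
  elast : 'I_N -> 'I_3 -> 'I_3 -> 'I_3 -> 'I_3 -> R3 R -> R;  (* C_aijkl *)
  force : 'I_N -> 'I_3 -> R3 R -> R;               (* f_a *)
  load : 'I_N -> 'I_3 -> R3 R -> R                 (* p_a *)
}.

Section contact.
Context {R : realType} {N : nat}.
Variables (dS : {measure set (R3 R) -> \bar R}) (P : contact_problem R N).
Implicit Types (a b : 'I_N).

Definition Gamma a : set (R3 R) := boundary (body P a).
Definition Sof a : set (R3 R) := \bigcup_(b in [set b | b \in nbr P a]) S P a b.
Definition Xi a : set (R3 R) := rel_interior (Gamma a) (Gamma a `\` Gamma_u P a).

(* The condition on [proj] is the quantitative content of "S_ab and S_ba are
   sufficiently close": x |-> g (x') is well defined on classes of functions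
   modulo null sets and maps L_2(S_ba) into L_2(S_ab). *)
Definition contact_geometry : Prop :=
  [/\ (forall a, [/\ open (body P a), bounded_set (body P a),
         lipschitz_boundary (body P a) & is_outer_normal dS (body P a) (normal P a)]),
      (forall a, is_trace_operator dS (body P a) (trace P a)),
      (forall a, [/\ Gamma a = Gamma_u P a `|` Gamma_s P a `|` Sof a,
         Gamma_u P a `&` Gamma_s P a `&` Sof a = set0,
         Gamma_u P a !=set0, Gamma_u P a = closure (Gamma_u P a) &
         measurable (Gamma_s P a) /\ Sof a !=set0]),
      (forall a b, (a \notin nbr P a) /\ (b \in nbr P a) = (a \in nbr P b)) &
      (forall a b, b \in nbr P a ->
         [/\ measurable (S P a b), lipschitz_surface (S P a b),
             (forall x, S P a b x -> S P b a (proj P a b x) /\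
                forall y, S P b a y -> enorm (x - proj P a b x) <= enorm (x - y)) &
             measurable_fun (S P a b) (proj P a b) /\
             exists K : R, forall E, measurable E -> E `<=` S P b a ->
               (dS (S P a b `&` proj P a b @^-1` E) <= K%:E * dS E)%E])].

Definition contact_gap : Prop :=
  forall a b, b \in nbr P a ->
    H1200 dS (Gamma a) (Xi a) (gap P a b) /\
    forall x, S P a b x -> `|gap P a b x| = enorm (x - proj P a b x).

Definition contact_loads : Prop :=
  forall a i, L2 vol (body P a) (force P a i) /\ L2 dS (Gamma_s P a) (load P a i).

Definition elasticity_tensor : Prop :=
  forall a i j k l, Linfty vol (body P a) (elast P a i j k l) /\
    {ae vol, forall x, body P a x ->
       elast P a i j k l x = elast P a j i k l x /\
       elast P a i j k l x = elast P a k l i j x}.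

Definition uniformly_elliptic (b d : R) : Prop :=
  forall a, {ae vol, forall x, body P a x ->
    forall eps : 'I_3 -> 'I_3 -> R, (forall i j, eps i j = eps j i) ->
      b * (\sum_i \sum_j eps i j ^+ 2)
        <= \sum_i \sum_j \sum_k \sum_l elast P a i j k l x * eps i j * eps k l /\
      \sum_i \sum_j \sum_k \sum_l elast P a i j k l x * eps i j * eps k l
        <= d * (\sum_k \sum_l eps k l ^+ 2)}.

(* u a i is the i-th component of the displacement of body a. *)
Definition displacement := 'I_N -> 'I_3 -> jet R.
Implicit Types u v w : displacement.

Definition V0 : set displacement :=
  [set u | forall a i, H1 (body P a) (u a i) /\
     {ae dS, forall x, Gamma_u P a x -> trace P a (u a i) x = 0}].

Definition V0ip u v : R := \sum_a \sum_i H1ip (body P a) (u a i) (v a i).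
Definition V0norm u : R := Num.sqrt (V0ip u u).

Definition strain u a i j (x : R3 R) : R := ((u a i).2 j x + (u a j).2 i x) / 2.
Definition stress u a i j (x : R3 R) : R :=
  \sum_k \sum_l elast P a i j k l x * strain u a k l x.

Definition Aform u v : R :=
  \sum_a \int[vol]_(x in body P a)
    (\sum_i \sum_j stress u a i j x * strain v a i j x).

Definition Lform v : R :=
  \sum_a (\int[vol]_(x in body P a) (\sum_i force P a i x * (v a i).1 x) +
          \int[dS]_(x in Gamma_s P a) (\sum_i load P a i x * trace P a (v a i) x)).

Definition ntrace u a (x : R3 R) : R :=
  \sum_i coord (normal P a x) i * trace P a (u a i) x.

Definition contact_pairs : {set {set 'I_N}} :=
  [set q : {set 'I_N} | [exists a, [exists b in nbr P a, q == [set a; b]]]]%SET.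

(* The surface integral attached to the unordered pair {a, b} is taken over
   S_ab, the quantities of body b being evaluated at x' = proj a b x; this
   needs an ordered representative (a, b) of the pair. *)
Definition orientation (ori : {set 'I_N} -> 'I_N * 'I_N) : Prop :=
  forall q, q \in contact_pairs ->
    (ori q).2 \in nbr P (ori q).1 /\ q = [set (ori q).1; (ori q).2]%SET.

Variables (ori : {set 'I_N} -> 'I_N * 'I_N) (theta : R).

Definition Jform u v : R :=
  - theta^-1 * \sum_(q in contact_pairs) let: (a, b) := ori q in
    \int[dS]_(x in S P a b)
      (Num.min 0 (gap P a b x - ntrace u a x - ntrace u b (proj P a b x)) *
       (ntrace v a x + ntrace v b (proj P a b x))).

Variable S1 : 'I_N -> 'I_N -> set (R3 R).

Definition contact_subareas : Prop :=
  forall a b, b \in nbr P a -> measurable (S1 a b) /\ S1 a b `<=` S P a b.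

Definition Xform u v : R :=
  theta^-1 * \sum_(q in contact_pairs) let: (a, b) := ori q in
    \int[dS]_(x in S P a b)
      (ntrace u a x * ntrace v a x * \1_(S1 a b) x +
       ntrace u b (proj P a b x) * ntrace v b (proj P a b x) *
         \1_(S1 b a) (proj P a b x)).

Definition Gform u v : R := Aform u v + Xform u v.
Definition Gnorm u : R := Num.sqrt (Gform u u).

Definition two_step_iteration (gamma : R) (u ut : nat -> displacement) : Prop :=
  forall k, [/\ V0 (ut k.+1),
    (forall v, V0 v -> Aform (ut k.+1) v + Xform (ut k.+1) v =
                       Lform v + Xform (u k) v - Jform (u k) v) &
    u k.+1 = gamma *: ut k.+1 + (1 - gamma) *: u k].

Definition G_iteration (gamma : R) (u : nat -> displacement) : Prop :=
  forall k v, V0 v ->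
    Gform (u k.+1) v =
      Gform (u k) v - gamma * (Aform (u k) v + Jform (u k) v - Lform v).

End contact.
Arguments displacement : clear implicits.

Definition rate {R : realType} (M B D Z gamma : R) : R :=
  Num.sqrt (1 - gamma * (2 * B - gamma * (M + D) ^+ 2 / B) / (M + Z)).

(* Main.v *)
Require Import Defs.
From HB Require Import structures.
From mathcomp Require Import all_boot all_order all_algebra.
From mathcomp Require Import all_classical all_reals all_analysis.
From mathcomp Require Import measurable_realfun ring lra.
Import Order.TTheory GRing.Theory Num.Theory.
Import numFieldNormedType.Exports.
Local Open Scope classical_set_scope.
Local Open Scope ring_scope.

Set Implicit Arguments.
Unset Strict Implicit.
Unset Printing Implicit Defensive.

(** The penalty functional J is monotone and Lipschitz, A is symmetric and
    coercive, X is symmetric and nonnegative; so one step of the method is a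
    step of a preconditioned gradient method for a strongly monotone equation,
    measured in the norm of its own preconditioner G = A + X.

    Write e, e' for the errors before and after a step, g = e' - e, and F for
    the difference of the residuals at u and at ubar, so that
    G(g, v) = - gamma F(v) for all v.  Expanding the square,
      G(e', e') = G(e, e) - 2 gamma F(e) + G(g, g).
    Monotonicity of J gives F(e) >= B |e|^2.  Since B |g|^2 <= G(g, g) =
    - gamma F(g) <= gamma (M + D) |e| |g|, one gets |g| <= gamma (M + D) |e| / B
    and G(g, g) <= gamma^2 (M + D)^2 |e|^2 / B.  Together
      G(e', e') <= G(e, e) - gamma (2 B - gamma (M + D)^2 / B) |e|^2,
    and |e|^2 >= G(e, e) / (M + Z) turns this into the factor q^2
    ([energy_contraction]).  As B |e|^2 <= G(e, e), geometric decay in the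
    G-norm is strong convergence in V_0 ([residual_steps_cvg]).  No solvability
    theory enters: the iterates are given, and the equivalence of the two forms
    of the method is linear algebra ([two_step_residual]), the auxiliary iterate
    being u^k + (u^{k+1} - u^k) / gamma.

    The analytic work lies in the facts about A, X and J that are not part of
    the bounds by M, B, D, Z.  Since integrals of non-integrable functions carry
    no linearity, each of them rests on the integrands being products of two
    L_2 functions.
    - V_0 is a linear space ([V0_linear]): weak derivatives add up because on a
      bounded body test functions and their derivatives are square integrable.
    - A is linear ([Aform_linear]) and symmetric ([Aform_sym]), the latter by
      the symmetry C_ijkl = C_klij.
    - X is linear ([Xform_linear]) although traces are linear only almost
      everywhere; on the opposite surface this needs the projection x |-> x' to
      pull null sets and L_2 functions back ([ae_comp], [L2_comp]).
    - J is monotone ([Jform_monotone]), because y |-> min(0, y) is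
      nondecreasing. *)

(** * Borel sets of three-dimensional space *)

(** The sigma-algebra is the product one; an open set belongs to it because it
    is a countable union of cubes with rational centre and rational radius. *)
Lemma open_measurable3 (R : realType) (A : set (R3 R)) : open A -> measurable A.
Proof.
move=> oA.
pose box (c : rat * rat * rat * rat) : set (R3 R) :=
  (ball (ratr c.1.1.1 : R) (ratr c.2) `*` ball (ratr c.1.1.2 : R) (ratr c.2))
  `*` ball (ratr c.1.2 : R) (ratr c.2).
have -> : A = \bigcup_(c : rat * rat * rat * rat)
    (if `[< box c `<=` A >] then box c else set0).
  apply/seteqP; split=> [x Ax|x [c _]]; last by case: asboolP => // sA /sA.
  have /nbhs_ballP[e /= e0 eA] : nbhs x A by exact: open_nbhs_nbhs.
  have [r /[!in_itv]/= /andP[r0 re]] :=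
    @rat_in_itvoo R 0 (e / 2) (divr_gt0 e0 (ltr0Sn _ _)).
  have app (y : R) : exists q : rat, `|ratr q - y| < ratr r.
    have yr : y < y + ratr r by rewrite ltrDl.
    have [q /[!in_itv]/= /andP[q1 q2]] := rat_in_itvoo yr.
    by exists q; rewrite ger0_norm ?subr_ge0 ?ltW// ltrBlDl.
  have [[a ha] [b hb] [c hc]] := And3 (app x.1.1) (app x.1.2) (app x.2).
  exists (a, b, c, r) => //=.
  have sA : box (a, b, c, r) `<=` A.
    move=> y [[/= y1 y2] y3]; apply: eA.
    have tri (p s t : R) : `|p - s| < ratr r -> ball p (ratr r) t -> ball s e t.
      rewrite -!ball_normE/= => h1 h2.
      rewrite (_ : s - t = - (p - s) + (p - t)); last by rewrite opprB addrA subrK.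
      apply: (le_lt_trans (ler_normD _ _)); rewrite normrN.
      by rewrite (splitr e); apply: ltrD; exact: lt_trans re.
    by split; [split|]; [apply: tri ha y1|apply: tri hb y2|apply: tri hc y3].
  by case: asboolP.
apply: countable_bigcupT_measurable => [|c]; first exact: countableP.
case: asboolP => // _.
by apply: measurableX; [apply: measurableX|]; apply: measurable_ball.
Qed.

Lemma continuous_measurable3 (R : realType) (f : R3 R -> R) (D : set (R3 R)) :
  continuous f -> measurable_fun D f.
Proof.
move=> cf; apply: measurable_funTS; apply: (measurability _ (RGenOpens.measurableE R)).
move=> _ [_ [a [b ->] <-]]; rewrite setTI; apply: open_measurable3.
by apply: open_comp => //; exact: interval_open.
Qed.

Lemma boundary_measurable (R : realType) (W : set (R3 R)) : measurable (boundary W).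
Proof.
apply: measurableD; last by apply: open_measurable3; exact: open_interior.
rewrite -[closure W]setCK; apply: measurableC; apply: open_measurable3.
by rewrite openC; exact: closed_closure.
Qed.

(** * Square-integrable functions *)

Section square_integrable.
Context {R : realType}.
Implicit Types (mu : {measure set (R3 R) -> \bar R}) (E : set (R3 R)).
Implicit Types f g h : R3 R -> R.

Lemma L2_dominated mu E f h : measurable E -> measurable_fun E h ->
  {ae mu, forall x, E x -> `|h x| <= `|f x|} -> L2 mu E f -> L2 mu E h.
Proof.
move=> mE mh hf [mf If]; split=> //; apply: le_lt_trans If.
apply: ae_ge0_le_integral => //.
- by move=> x _; rewrite lee_fin sqr_ge0.
- by apply/measurable_EFinP; exact: measurable_funX.
- by move=> x _; rewrite lee_fin sqr_ge0.
- by apply/measurable_EFinP; exact: measurable_funX.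
- apply: filterS hf => x hx Ex; rewrite lee_fin.
  rewrite -(real_normK (num_real (h x))) -(real_normK (num_real (f x))).
  by rewrite lerXn2r ?nnegrE// hx.
Qed.

Lemma L2_subset mu E E' f : measurable E -> measurable E' -> E' `<=` E ->
  L2 mu E f -> L2 mu E' f.
Proof.
move=> mE mE' sE [mf If]; split; first exact: measurable_funS mf.
apply: le_lt_trans If; apply: ge0_subset_integral => //.
  by apply/measurable_EFinP; exact: measurable_funX.
by move=> x _; rewrite lee_fin sqr_ge0.
Qed.

Lemma L2Z mu E (c : R) f : measurable E -> L2 mu E f -> L2 mu E (fun x => c * f x).
Proof.
move=> mE [mf If]; split; first exact: measurable_funM.
under eq_integral do rewrite exprMn EFinM.
rewrite ge0_integralZl_EFin ?sqr_ge0//.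
- by apply: lte_mul_pinfty => //; rewrite lee_fin sqr_ge0.
- by move=> x _; rewrite lee_fin sqr_ge0.
- by apply/measurable_EFinP; exact: measurable_funX.
Qed.

Lemma integrable_sqr mu E f : L2 mu E f ->
  mu.-integrable E (EFin \o (fun x => f x ^+ 2)).
Proof.
move=> [mf If]; apply/integrableP; split.
  by apply/measurable_EFinP; exact: measurable_funX.
by under eq_integral do rewrite /= ger0_norm ?sqr_ge0//.
Qed.

(** From |f g| <= f^2 + g^2. *)
Lemma integrable_mul mu E f g : measurable E -> L2 mu E f -> L2 mu E g ->
  mu.-integrable E (EFin \o (fun x => f x * g x)).
Proof.
move=> mE Lf Lg.
have := integrableD mE (integrable_sqr Lf) (integrable_sqr Lg).
apply: le_integrable => //.
  by apply/measurable_EFinP; case: Lf Lg => [mf _] [mg _]; exact: measurable_funM.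
move=> x _ /=; rewrite lee_fin normrM [leRHS]ger0_norm ?addr_ge0 ?sqr_ge0//.
rewrite -(real_normK (num_real (f x))) -(real_normK (num_real (g x))).
by have := sqr_ge0 (`|f x| - `|g x|); have := sqr_ge0 (`|f x| + `|g x|); nra.
Qed.

Lemma L2D mu E f g : measurable E -> L2 mu E f -> L2 mu E g ->
  L2 mu E (fun x => f x + g x).
Proof.
move=> mE Lf Lg.
have mfg : measurable_fun E (fun x => f x + g x).
  by case: Lf Lg => [mf _] [mg _]; exact: measurable_funD.
split=> //.
have Isum := integrableD mE (integrable_sqr Lf) (integrable_sqr Lg).
have : mu.-integrable E (EFin \o (fun x => (f x + g x) ^+ 2)).
  apply: (le_integrable mE _ _ (integrableD mE Isum Isum)).
    by apply/measurable_EFinP; exact: measurable_funX.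
  move=> x _ /=; rewrite lee_fin !ger0_norm ?addr_ge0 ?sqr_ge0//.
  by have := sqr_ge0 (f x - g x); nra.
by move=> /integrableP[_]; under eq_integral do rewrite /= ger0_norm ?sqr_ge0//.
Qed.

Lemma L20 mu E : measurable E -> L2 mu E (fun=> 0).
Proof.
move=> mE; split; first exact: measurable_cst.
by under eq_integral do rewrite expr0n/=; rewrite integral0.
Qed.

Lemma L2_sum mu E (I : Type) (r : seq I) (F : I -> R3 R -> R) : measurable E ->
  (forall i, L2 mu E (F i)) -> L2 mu E (fun x => \sum_(i <- r) F i x).
Proof.
move=> mE LF; elim: r => [|i r IH].
  by under eq_fun do rewrite big_nil; exact: L20.
by under eq_fun do rewrite big_cons; exact: L2D.
Qed.

Lemma L2_mul_bounded mu E (K : R) f h : measurable E -> measurable_fun E h ->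
  {ae mu, forall x, E x -> `|h x| <= K} -> L2 mu E f ->
  L2 mu E (fun x => h x * f x).
Proof.
move=> mE mh hK Lf; apply: (@L2_dominated _ _ (fun x => K * f x)) => //.
- by case: Lf => mf _; exact: measurable_funM.
- apply: filterS hK => x hx Ex; rewrite !normrM ler_wpM2r//.
  by rewrite (le_trans (hx Ex))// ler_norm.
- exact: L2Z.
Qed.

Lemma integrable_sumr mu E (I : Type) (r : seq I) (F : I -> R3 R -> R) :
  measurable E -> (forall i, mu.-integrable E (EFin \o F i)) ->
  mu.-integrable E (EFin \o (fun x => \sum_(i <- r) F i x)).
Proof.
move=> mE IF; elim: r => [|i r IH].
  by under eq_fun do rewrite big_nil; exact: integrable0.
by under eq_fun do rewrite big_cons; exact: (integrableD mE (IF i) IH).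
Qed.

Lemma ae_forall_fin mu (I : finType) (Q : I -> R3 R -> Prop) :
  (forall i, {ae mu, forall x, Q i x}) -> {ae mu, forall x, forall i, Q i x}.
Proof.
move=> aeQ.
have : {ae mu, forall x, forall n, if @unpickle I n is Some i then Q i x else True}.
  by apply: ae_foralln => n; case: unpickle => [i|]; [exact: aeQ|exact: aeW].
by apply: filterS => x Qx i; have := Qx (pickle i); rewrite pickleK.
Qed.

Lemma ae_eq_Rintegral mu E f g : measurable E -> measurable_fun E f ->
  measurable_fun E g -> {ae mu, forall x, E x -> f x = g x} ->
  \int[mu]_(x in E) f x = \int[mu]_(x in E) g x.
Proof.
move=> mE mf mg fg; congr fine; apply: ae_eq_integral => //.
- exact/measurable_EFinP.
- exact/measurable_EFinP.
- by apply: filterS fg => x fgx Ex; rewrite fgx.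
Qed.

(** Linearity of the integral in the form in which traces need it: the integrand
    is a linear combination only up to a null set. *)
Lemma Rintegral_ae_linear mu E (c : R) f g h : measurable E ->
  mu.-integrable E (EFin \o f) -> mu.-integrable E (EFin \o g) ->
  measurable_fun E h ->
  {ae mu, forall x, E x -> h x = c * f x + g x} ->
  \int[mu]_(x in E) h x = c * \int[mu]_(x in E) f x + \int[mu]_(x in E) g x.
Proof.
move=> mE If Ig mh hfg.
have Icf : mu.-integrable E (EFin \o (fun x => c * f x)).
  exact: (integrableZl mE c If).
rewrite -RintegralZl// -RintegralD//; apply: ae_eq_Rintegral => //.
apply: measurable_funD; apply/measurable_EFinP.
- by case/integrableP: Icf.
- by case/integrableP: Ig.
Qed.

(** If phi maps E into F and the image measure of mu on E is at most K mu on F,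
    change of variables bounds integrals of f o phi over E by integrals of f
    over F.  The comparison of measures must hold on all of space, hence the
    extension of phi off E, of f by zero off F, and the splitting of mu into its
    restrictions to E and to the complement. *)
Lemma ge0_integral_comp_le mu E F (phi : R3 R -> R3 R) (K : R) f :
  measurable E -> measurable F -> measurable_fun E phi ->
  (forall x, E x -> F (phi x)) ->
  (forall A, measurable A -> A `<=` F ->
     (mu (E `&` phi @^-1` A) <= K%:E * mu A)%E) ->
  measurable_fun F f -> (forall x, 0 <= f x) ->
  (\int[mu]_(x in E) (f (phi x))%:E <= `|K|%:E * \int[mu]_(x in F) (f x)%:E)%E.
Proof.
move=> mE mF mphi phiF muK mf f0.
pose phi' := patch (fun=> point) E phi.
have mphi' : measurable_fun setT phi'.
  by apply/measurable_restrict; rewrite ?setTI.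
pose h : R3 R -> \bar R := (EFin \o f) \_ F.
have h0 x : (0 <= h x)%E.
  by rewrite /h /patch; case: ifP => //= _; rewrite lee_fin.
have mh : measurable_fun setT h.
  by apply/measurable_restrict; rewrite ?setTI//; apply/measurable_EFinP.
have mhp : measurable_fun setT (h \o phi') by exact: measurableT_comp.
have -> : (\int[mu]_(x in E) (f (phi x))%:E = \int[mu]_(x in E) (h \o phi') x)%E.
  apply: eq_integral => x xE; rewrite /= /phi' /h /patch xE.
  by rewrite mem_set//=; exact/phiF/set_mem.
have split_mu A : measurable A ->
    (mu A <= measure_add (mrestr mu mE) (mrestr mu (measurableC mE)) A)%E.
  move=> mA; rewrite measure_addE /mrestr /=.
  rewrite -[X in (X <= _)%E](_ : mu ((A `&` E) `|` (A `&` ~` E)) = _).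
    rewrite measureU//; [exact: measurableI| |by rewrite setIACA setICr setI0].
    by apply: measurableI => //; exact: measurableC.
  by rewrite -setIUr setUv setIT.
apply: (le_trans (ge0_le_measure_integral split_mu mE (fun x => h0 (phi' x)) mhp)).
rewrite ge0_integral_measure_add//; last 1 first.
  exact: measurable_funTS.
rewrite [X in (_ + X)%E](_ : _ = 0%E) ?adde0; last first.
  apply: null_set_integral => //; first exact: measurable_funTS.
  by transitivity (mu (E `&` ~` E)) => //; rewrite setICr measure0.
apply: (@le_trans _ _ (\int[mrestr mu mE]_x (h \o phi') x)%E).
  by apply: ge0_subset_integral => //.
rewrite -[setT](preimage_setT phi') -(ge0_integral_pushforward mphi')//.
have push_le A : measurable A ->
    (pushforward (mrestr mu mE) phi' A <= mscale (NngNum (normr_ge0 K)) mu A)%E.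
  move=> mA; rewrite /pushforward /mrestr /mscale/=.
  have -> : phi' @^-1` A `&` E = E `&` phi @^-1` (A `&` F).
    apply/seteqP; split=> x /=.
      move=> [Ax Ex]; move: Ax; rewrite /phi' /patch mem_set//.
      by split=> //; split=> //; exact: phiF.
    by move=> [Ex [Ax Fx]]; split=> //; rewrite /phi' /patch mem_set.
  apply: (le_trans (muK _ (measurableI _ _ mA mF) _)) => //.
  apply: (@le_trans _ _ (`|K|%:E * mu (A `&` F))%E).
    by rewrite lee_wpmul2r// lee_fin ler_norm.
  by rewrite lee_wpmul2l ?lee_fin// le_measure// inE//; exact: measurableI.
apply: (le_trans (ge0_le_measure_integral push_le measurableT h0 mh)).
  exact: mphi'.
by rewrite ge0_integral_mscale//= /h -integral_mkcond.
Qed.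

Lemma L2_comp mu E F (phi : R3 R -> R3 R) (K : R) f :
  measurable E -> measurable F -> measurable_fun E phi ->
  (forall x, E x -> F (phi x)) ->
  (forall A, measurable A -> A `<=` F ->
     (mu (E `&` phi @^-1` A) <= K%:E * mu A)%E) ->
  L2 mu F f -> L2 mu E (fun x => f (phi x)).
Proof.
move=> mE mF mphi phiF muK [mf If]; split.
  by apply: (measurable_comp mF _ mf mphi) => _ [x Ex <-]; exact: phiF.
apply: le_lt_trans (ge0_integral_comp_le (f := fun x => f x ^+ 2)
  mE mF mphi phiF muK _ _) _.
- exact: measurable_funX.
- by move=> x; exact: sqr_ge0.
- exact: lte_mul_pinfty.
Qed.

Lemma ae_comp mu E F (phi : R3 R -> R3 R) (K : R) (Q : R3 R -> Prop) :
  measurable E -> measurable F -> measurable_fun E phi ->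
  (forall x, E x -> F (phi x)) ->
  (forall A, measurable A -> A `<=` F ->
     (mu (E `&` phi @^-1` A) <= K%:E * mu A)%E) ->
  {ae mu, forall x, F x -> Q x} -> {ae mu, forall x, E x -> Q (phi x)}.
Proof.
move=> mE mF mphi phiF muK [A [mA A0 QA]].
exists (E `&` phi @^-1` (A `&` F)); split.
- by apply: mphi => //; exact: measurableI.
- apply/eqP; rewrite eq_le measure_ge0 andbT.
  apply: (le_trans (muK _ (measurableI _ _ mA mF) _)) => //.
  by rewrite (subset_measure0 _ _ _ A0) ?mule0//; exact: measurableI.
- move=> x /= /not_implyP[Ex nQ]; split=> //; split; last exact: phiF.
  by apply: QA => /= /(_ (phiF _ Ex)).
Qed.

End square_integrable.

(** * Linearity of the Sobolev space *)

Section sobolev.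
Context {R : realType}.
Implicit Types (W : set (R3 R)) (f g phi : R3 R -> R) (u v : jet R).

Lemma bounded_box W : bounded_set W ->
  exists2 r : R, 0 < r & W `<=` (`[- r, r] `*` `[- r, r]) `*` `[- r, r].
Proof.
move=> [M [Mreal WM]]; exists (`|M| + 1); first by rewrite ltr_wpDl.
move=> x /(WM (`|M| + 1)) xM.
have {}xM : `|x| <= `|M| + 1.
  by apply: xM; rewrite (le_lt_trans (ler_norm M))// ltrDl.
have [x12 x3] : `|x.1| <= `|M| + 1 /\ `|x.2| <= `|M| + 1.
  by move: xM; rewrite [`|x|]prod_normE/= ge_max => /andP[].
have [x1 x2] : `|x.1.1| <= `|M| + 1 /\ `|x.1.2| <= `|M| + 1.
  by move: x12; rewrite [`|x.1|]prod_normE/= ge_max => /andP[].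
by split; [split|]; rewrite /= in_itv/= -ler_norml.
Qed.

Lemma vol_bounded W : measurable W -> bounded_set W -> (vol W < +oo)%E.
Proof.
move=> mW /bounded_box[r r0 Wr].
pose I : set R := `[- r, r]%classic.
have mI : measurable I by exact: measurable_itv.
have mI3 : measurable ((I `*` I) `*` I).
  by apply: measurableX => //; exact: measurableX.
apply: (@le_lt_trans _ _ (vol ((I `*` I) `*` I))).
  by apply: le_measure; rewrite ?inE.
have -> : vol ((I `*` I) `*` I) = (leb1 I * leb1 I * leb1 I)%E.
  apply: etrans (product_measure1E _ _ (measurableX mI mI) mI) _.
  by congr (_ * _)%E; exact: product_measure1E.
have -> : leb1 I = (r + r)%:E.
  rewrite /leb1 lebesgue_measure_itv/= lte_fin.
  by rewrite (lt_trans _ r0) ?oppr_lt0//= opprK.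
by rewrite -!EFinM ltry.
Qed.

Lemma continuous_bounded W g : bounded_set W -> continuous g ->
  exists K : R, forall x, W x -> `|g x| <= K.
Proof.
move=> /bounded_box[r r0 Wr] cg.
have cK : compact (g @` ((`[- r, r] `*` `[- r, r]) `*` `[- r, r])).
  apply: continuous_compact; first exact: continuous_subspaceT.
  by do 2?apply: compact_setX; exact: segment_compact.
have [M [Mreal gM]] := compact_bounded cK.
exists (`|M| + 1) => x Wx; apply: gM; last by exists x => //; exact: Wr.
by rewrite (le_lt_trans (ler_norm M))// ltrDl.
Qed.

(** This makes every product of an L_2 function with a test function, or with one
    of its derivatives, integrable. *)
Lemma L2_continuous W g : measurable W -> bounded_set W -> continuous g ->
  L2 vol W g.
Proof.
move=> mW bW cg; have [K gK] := continuous_bounded bW cg.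
have -> : g = (fun x => g x * 1) by apply/funext => x; rewrite mulr1.
apply: (@L2_mul_bounded _ _ _ K) => //.
- exact: continuous_measurable3.
- exact: aeW.
- split; first exact: measurable_cst.
  under eq_integral do rewrite expr1n.
  by rewrite integral_cst// mul1e vol_bounded.
Qed.

Lemma jet_linearE (c : R) u v :
  c *: u + v = ((fun x => c * u.1 x + v.1 x), (fun j x => c * u.2 j x + v.2 j x)).
Proof. by []. Qed.

Lemma H1_linear W (c : R) u v : open W -> bounded_set W ->
  H1 W u -> H1 W v -> H1 W (c *: u + v).
Proof.
move=> oW bW [Lu Lgu wu] [Lv Lgv wv].
rewrite (jet_linearE c u v).
have mW := open_measurable3 oW.
split=> [|j|j phi tphi].
- by apply: L2D => //; exact: L2Z.
- by apply: L2D => //; exact: L2Z.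
have [sphi _] := tphi.
have cphi : continuous phi by have [] := sphi 0%N.
have cdphi : continuous (partial j phi) by have [_ /(_ j)[_ []]] := sphi 1%N.
have Lphi := L2_continuous mW bW cphi.
have Ldphi := L2_continuous mW bW cdphi.
have mprod f g : L2 vol W f -> L2 vol W g -> measurable_fun W (fun x => f x * g x).
  by move=> [mf _] [mg _]; exact: measurable_funM.
rewrite (@Rintegral_ae_linear _ _ _ c (fun x => u.1 x * partial j phi x)
  (fun x => v.1 x * partial j phi x)) //; last 4 first.
- exact: integrable_mul.
- exact: integrable_mul.
- by apply: mprod => //; apply: L2D => //; exact: L2Z.
- by apply: aeW => x _ /=; rewrite mulrDl mulrA.
rewrite (@Rintegral_ae_linear _ _ _ c (fun x => u.2 j x * phi x)
  (fun x => v.2 j x * phi x)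
  (fun x => (c * u.2 j x + v.2 j x) * phi x)) //; last 4 first.
- by apply: integrable_mul => //; exact: Lgu.
- by apply: integrable_mul => //; exact: Lgv.
- by apply: mprod => //; apply: L2D => //; exact: L2Z.
- by apply: aeW => x _ /=; rewrite mulrDl mulrA.
by rewrite (wu j phi tphi) (wv j phi tphi) mulrN opprD.
Qed.

End sobolev.

(** * Displacements as a module *)

Section displacement_module.
Context {R : realType} {N : nat}.
Implicit Types u v : displacement R N.

(** The addition of displacements can be read through several structures, all of
    them equal but slow to unify; the lemmas below translate once and for all to
    the operations of this module.  Where a proof is given by an explicit term,
    this term is the common normal form of both sides. *)
Definition displacement_lmod : lmodType R := displacement R N.
Local Notation V := displacement_lmod.

Lemma displacement_addE u v :
  @eq (displacement R N) (u + v) (@GRing.add V u v).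
Proof.
exact (erefl (fun a i => ((fun x => (u a i).1 x + (v a i).1 x),
  (fun j x => (u a i).2 j x + (v a i).2 j x)) : jet R)).
Qed.

Lemma displacement_subE u v :
  @eq (displacement R N) (u - v) (@GRing.add V u (@GRing.opp V v)).
Proof.
exact (erefl (fun a i => ((fun x => (u a i).1 x - (v a i).1 x),
  (fun j x => (u a i).2 j x - (v a i).2 j x)) : jet R)).
Qed.

Lemma displacement_linearE (c : R) u v :
  @eq (displacement R N) (c *: u + v) (@GRing.add V (@GRing.scale R V c u) v).
Proof. by []. Qed.

Lemma displacement_combE (c d : R) u v :
  @eq (displacement R N) (c *: u + d *: v)
    (@GRing.add V (@GRing.scale R V c u) (@GRing.scale R V d v)).
Proof. by []. Qed.

Lemma displacement_add1E u v : @eq (displacement R N) (u + v) (1 *: u + v).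
Proof. by rewrite displacement_addE -[u in LHS](@scale1r R V). Qed.

End displacement_module.
Arguments displacement_lmod : clear implicits.

(** * The space of admissible displacements *)

Section contact_forms.
Context {R : realType} {N : nat}.
Context (dS : {measure set (R3 R) -> \bar R}) (P : contact_problem R N).
Context (hgeo : contact_geometry dS P).
Implicit Types (a b : 'I_N) (u v w : displacement R N) (c : R).

Lemma body_open a : open (body P a).
Proof. by have [/(_ a)[]] := hgeo. Qed.

Lemma body_bounded a : bounded_set (body P a).
Proof. by have [/(_ a)[]] := hgeo. Qed.

Lemma body_measurable a : measurable (body P a).
Proof. by apply: open_measurable3; exact: body_open. Qed.

Lemma trace_operator a : is_trace_operator dS (body P a) (trace P a).
Proof. by have [_ + _ _ _] := hgeo. Qed.

Lemma Gamma_measurable a : measurable (Gamma P a).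
Proof. exact: boundary_measurable. Qed.

Lemma Gamma_u_sub a : Gamma_u P a `<=` Gamma P a.
Proof. by have [_ _ /(_ a)[-> _ _ _ _] _ _] := hgeo => x ?; left; left. Qed.

Lemma V0_linear c u v : V0 dS P u -> V0 dS P v -> V0 dS P (c *: u + v).
Proof.
move=> Vu Vv a i; have [Hu tu] := Vu a i; have [Hv tv] := Vv a i.
rewrite -[(c *: u + v) a i]/(c *: u a i + v a i).
split; first by apply: H1_linear => //; [exact: body_open|exact: body_bounded].
have [_ /(_ c _ _ Hu Hv) tlin _ _ _] := trace_operator a.
apply: filterS3 tlin tu tv => x tx ux vx Gx.
by rewrite (tx (Gamma_u_sub Gx)) ux// vx// mulr0 addr0.
Qed.

Lemma V0D u v : V0 dS P u -> V0 dS P v -> V0 dS P (u + v).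
Proof. by move=> Vu Vv; rewrite displacement_add1E; exact: V0_linear. Qed.

End contact_forms.

(** * The elastic form *)

Section elasticity.
Context {R : realType} {N : nat}.
Context (dS : {measure set (R3 R) -> \bar R}) (P : contact_problem R N).
Context (hgeo : contact_geometry dS P) (helast : elasticity_tensor P).
Implicit Types (a b : 'I_N) (u v w : displacement R N) (c : R) (i j k l : 'I_3).

Lemma strain_L2 u a i j : V0 dS P u -> L2 vol (body P a) (strain u a i j).
Proof.
move=> Vu; have [[_ Li _] _] := Vu a i; have [[_ Lj _] _] := Vu a j.
have mW := body_measurable hgeo a.
have -> : strain u a i j = fun x => 2^-1 * ((u a i).2 j x + (u a j).2 i x).
  by apply/funext => x; rewrite mulrC.
by apply: L2Z => //; apply: L2D.
Qed.

Lemma stress_L2 u a i j : V0 dS P u -> L2 vol (body P a) (stress P u a i j).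
Proof.
move=> Vu; have mW := body_measurable hgeo a.
apply: L2_sum => // k; apply: L2_sum => // l.
have [[mC [K CK]] _] := helast a i j k l.
by apply: L2_mul_bounded mC CK _ => //; exact: strain_L2.
Qed.

Lemma strain_linear c u v a i j x :
  strain (c *: u + v) a i j x = c * strain u a i j x + strain v a i j x.
Proof.
rewrite /strain.
have lin (s t : 'I_3) :
    ((c *: u + v) a s).2 t x = c * (u a s).2 t x + (v a s).2 t x by [].
by rewrite !lin; field.
Qed.

Lemma stress_linear c u v a i j x :
  stress P (c *: u + v) a i j x = c * stress P u a i j x + stress P v a i j x.
Proof.
rewrite /stress mulr_sumr -big_split; apply: eq_bigr => k _.
rewrite mulr_sumr -big_split; apply: eq_bigr => l _ /=.
by rewrite strain_linear; ring.
Qed.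

(** The coefficients are essentially bounded, so stresses are as square
    integrable as strains. *)
Lemma work_integrable u v a : V0 dS P u -> V0 dS P v ->
  vol.-integrable (body P a)
    (EFin \o (fun x => \sum_i \sum_j stress P u a i j x * strain v a i j x)).
Proof.
move=> Vu Vv; have mW := body_measurable hgeo a.
apply: integrable_sumr => // i; apply: integrable_sumr => // j.
by apply: integrable_mul => //; [exact: stress_L2|exact: strain_L2].
Qed.

Lemma Aform_linear c u v w : V0 dS P u -> V0 dS P v -> V0 dS P w ->
  Aform P (c *: u + v) w = c * Aform P u w + Aform P v w.
Proof.
move=> Vu Vv Vw; rewrite /Aform mulr_sumr -big_split; apply: eq_bigr => a _ /=.
have Vuv := V0_linear hgeo c Vu Vv.
apply: Rintegral_ae_linear.
- exact: (body_measurable hgeo).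
- exact: work_integrable.
- exact: work_integrable.
- by have /integrableP[/measurable_EFinP] := work_integrable a Vuv Vw.
apply: aeW => x _; rewrite mulr_sumr -big_split; apply: eq_bigr => i _ /=.
rewrite mulr_sumr -big_split; apply: eq_bigr => j _ /=.
by rewrite stress_linear; ring.
Qed.

Lemma Aform_sym u v : V0 dS P u -> V0 dS P v -> Aform P u v = Aform P v u.
Proof.
move=> Vu Vv; apply: eq_bigr => a _.
have mint u' v' : V0 dS P u' -> V0 dS P v' -> measurable_fun (body P a)
    (fun x => \sum_i \sum_j stress P u' a i j x * strain v' a i j x).
  by move=> Vu' Vv'; have /integrableP[/measurable_EFinP] := work_integrable a Vu' Vv'.
apply: ae_eq_Rintegral; [exact: (body_measurable hgeo)|exact: mint|exact: mint|].
have : {ae vol, forall x, forall (p : ('I_3 * 'I_3) * ('I_3 * 'I_3)), body P a x ->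
    elast P a p.1.1 p.1.2 p.2.1 p.2.2 x = elast P a p.2.1 p.2.2 p.1.1 p.1.2 x}.
  apply: ae_forall_fin => -[[i j] [k l]].
  by have [_] := helast a i j k l; apply: filterS => x + Wx => /(_ Wx)[].
apply: filterS => x sym Wx.
have workE u' v' : \sum_i \sum_j stress P u' a i j x * strain v' a i j x =
    \sum_(p : 'I_3 * 'I_3) \sum_(q : 'I_3 * 'I_3)
      elast P a p.1 p.2 q.1 q.2 x * strain u' a q.1 q.2 x * strain v' a p.1 p.2 x.
  rewrite pair_big; apply: eq_bigr => p _ /=.
  by rewrite /stress pair_big/= mulr_suml.
rewrite !workE exchange_big; apply: eq_bigr => q _; apply: eq_bigr => p _ /=.
by rewrite (sym (p, q) Wx) /=; ring.
Qed.

End elasticity.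

(** * Traces on the contact surfaces, the form X and the penalty functional *)

Section contact_surface.
Context {R : realType} {N : nat}.
Context (dS : {measure set (R3 R) -> \bar R}) (P : contact_problem R N).
Context (hgeo : contact_geometry dS P).
Implicit Types (a b : 'I_N) (u v w : displacement R N) (c : R).

Lemma H12_L2 G g : H12 dS G g -> L2 dS G g.
Proof.
move=> [mg gfin]; split=> //; apply: le_lt_trans gfin.
rewrite /H12_norm2 leeDl// integral_ge0// => x _; rewrite integral_ge0// => y _.
by rewrite lee_fin divr_ge0 ?sqr_ge0// exprn_ge0// sqrtr_ge0.
Qed.

Lemma normal_coord_measurable a (i : 'I_3) :
  measurable_fun (Gamma P a) (fun x => Defs.coord (normal P a x) i).
Proof.
have [/(_ a)[_ _ _ [mn _]] _ _ _ _] := hgeo.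
case: i => -[|[|[|//]]] ilt; rewrite /Defs.coord /=.
- apply: (measurableT_comp measurable_fst).
  exact: (measurableT_comp measurable_fst mn).
- apply: (measurableT_comp measurable_snd).
  exact: (measurableT_comp measurable_fst mn).
- exact: (measurableT_comp measurable_snd mn).
Qed.

Lemma normal_coord_le1 a (i : 'I_3) :
  {ae dS, forall x, Gamma P a x -> `|Defs.coord (normal P a x) i| <= 1}.
Proof.
have [/(_ a)[_ _ _ [_ n1]] _ _ _ _] := hgeo.
apply: filterS n1 => x /[apply] -[nx _].
have n2 : dot (normal P a x) (normal P a x) = 1.
  have := congr1 (fun t => t ^+ 2) nx; rewrite /enorm sqr_sqrtr ?expr1n//.
  by apply: sumr_ge0 => j _; rewrite -expr2 sqr_ge0.
rewrite -(ler_pXn2r (n := 2)) ?nnegrE// expr1n real_normK ?num_real// -n2.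
rewrite /dot (bigD1 i)//= -expr2 lerDl.
by apply: sumr_ge0 => j _; rewrite -expr2 sqr_ge0.
Qed.

(** The coordinates of the unit normal are bounded by 1, and a trace lies in
    H^{1/2}, hence in L_2. *)
Lemma ntrace_L2 u a : V0 dS P u -> L2 dS (Gamma P a) (ntrace P u a).
Proof.
move=> Vu; have mG := Gamma_measurable P a.
apply: L2_sum => // i; have [Hui _] := Vu a i.
apply: (@L2_mul_bounded _ _ _ 1) => //.
- exact: normal_coord_measurable.
- exact: normal_coord_le1.
- by apply: H12_L2; have [tr _ _ _ _] := trace_operator hgeo a; exact: tr.
Qed.

Lemma ntrace_linear c u v a : V0 dS P u -> V0 dS P v ->
  {ae dS, forall x, Gamma P a x ->
     ntrace P (c *: u + v) a x = c * ntrace P u a x + ntrace P v a x}.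
Proof.
move=> Vu Vv.
have : {ae dS, forall x, forall i : 'I_3, Gamma P a x ->
    trace P a ((c *: u + v) a i) x = c * trace P a (u a i) x + trace P a (v a i) x}.
  apply: ae_forall_fin => i; have [_ lin _ _ _] := trace_operator hgeo a.
  by have [Hu _] := Vu a i; have [Hv _] := Vv a i; exact: lin.
apply: filterS => x lin Gx; rewrite /ntrace mulr_sumr -big_split.
by apply: eq_bigr => i _ /=; rewrite lin//; ring.
Qed.

Section pair.
Context (a b : 'I_N) (ab : b \in nbr P a).

Lemma nbr_sym : a \in nbr P b.
Proof. by have [_ _ _ /(_ a b)[_ <-] _] := hgeo. Qed.

Lemma S_measurable : measurable (S P a b).
Proof. by have [_ _ _ _ /(_ a b ab)[]] := hgeo. Qed.

Lemma S_sub : S P a b `<=` Gamma P a.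
Proof.
by have [_ _ /(_ a)[-> _ _ _ _] _ _] := hgeo => x Sx; right; exists b.
Qed.

Lemma proj_measurable : measurable_fun (S P a b) (Defs.proj P a b).
Proof. by have [_ _ _ _ /(_ a b ab)[_ _ _ []]] := hgeo. Qed.

Lemma proj_S x : S P a b x -> S P b a (Defs.proj P a b x).
Proof. by have [_ _ _ _ /(_ a b ab)[_ _ pS _] /pS[]] := hgeo. Qed.

Lemma proj_quasi_measure_preserving : exists K : R, forall E, measurable E ->
  E `<=` S P b a -> (dS (S P a b `&` Defs.proj P a b @^-1` E) <= K%:E * dS E)%E.
Proof. by have [_ _ _ _ /(_ a b ab)[_ _ _ []]] := hgeo. Qed.

End pair.

Lemma ntrace_L2_contact a b u : b \in nbr P a -> V0 dS P u ->
  L2 dS (S P a b) (ntrace P u a).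
Proof.
move=> ab Vu; apply: L2_subset (S_sub ab) (ntrace_L2 a Vu).
- exact: Gamma_measurable.
- exact: S_measurable.
Qed.

(** Quantities of body b at the projected points stay square integrable since
    the projection compresses surface measure by a bounded factor at most. *)
Lemma ntrace_L2_opposite a b u : b \in nbr P a -> V0 dS P u ->
  L2 dS (S P a b) (fun x => ntrace P u b (Defs.proj P a b x)).
Proof.
move=> ab Vu; have ba := nbr_sym ab.
have [K PK] := proj_quasi_measure_preserving ab.
apply: (L2_comp _ _ _ _ PK (ntrace_L2_contact ba Vu)).
- exact: S_measurable.
- exact: S_measurable.
- exact: proj_measurable.
- exact: proj_S.
Qed.

Lemma ntrace_linear_contact a b c u v : b \in nbr P a ->
  V0 dS P u -> V0 dS P v ->
  {ae dS, forall x, S P a b x ->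
     ntrace P (c *: u + v) a x = c * ntrace P u a x + ntrace P v a x}.
Proof.
move=> ab Vu Vv; apply: filterS (ntrace_linear c a Vu Vv) => x + Sx.
by apply; exact: S_sub Sx.
Qed.

Lemma ntrace_linear_opposite a b c u v : b \in nbr P a ->
  V0 dS P u -> V0 dS P v ->
  {ae dS, forall x, S P a b x -> let y := Defs.proj P a b x in
     ntrace P (c *: u + v) b y = c * ntrace P u b y + ntrace P v b y}.
Proof.
move=> ab Vu Vv; have ba := nbr_sym ab.
have [K PK] := proj_quasi_measure_preserving ab.
apply: (ae_comp _ _ _ _ PK (ntrace_linear_contact c ba Vu Vv)).
- exact: S_measurable.
- exact: S_measurable.
- exact: proj_measurable.
- exact: proj_S.
Qed.

Section penalty.
Context (ori : {set 'I_N} -> 'I_N * 'I_N) (hori : orientation P ori).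
Context (theta : R) (htheta : 0 < theta).

Lemma theta_inv_ge0 : 0 <= theta^-1.
Proof. by rewrite invr_ge0 ltW. Qed.

Section subareas.
Context (S1 : 'I_N -> 'I_N -> set (R3 R)) (hS1 : contact_subareas P S1).

Definition xdensity a b u v (x : R3 R) : R :=
  ntrace P u a x * ntrace P v a x * \1_(S1 a b) x +
  ntrace P u b (Defs.proj P a b x) * ntrace P v b (Defs.proj P a b x) *
    \1_(S1 b a) (Defs.proj P a b x).

Lemma indic_le1 (A : set (R3 R)) x : `|\1_A x : R| <= 1.
Proof. by rewrite indicE; case: (x \in A); rewrite /= ?normr1 ?normr0. Qed.

Lemma xdensity_integrable a b u v : b \in nbr P a -> V0 dS P u -> V0 dS P v ->
  dS.-integrable (S P a b) (EFin \o xdensity a b u v).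
Proof.
move=> ab Vu Vv; have ba := nbr_sym ab; have mS := S_measurable ab.
have [m1 _] := hS1 ab; have [m2 _] := hS1 ba.
have mi (A : set (R3 R)) (D : set (R3 R)) :
    measurable A -> measurable_fun D (\1_A : R3 R -> R).
  by move=> mA; apply: measurable_funTS; exact: measurable_indic.
have Lu : L2 dS (S P a b) (fun x => \1_(S1 a b) x * ntrace P u a x).
  apply: (@L2_mul_bounded _ _ _ 1) => //.
  - by apply: aeW => x _; exact: indic_le1.
  - exact: ntrace_L2_contact.
have Lu' : L2 dS (S P a b) (fun x => \1_(S1 b a) (Defs.proj P a b x) *
                                     ntrace P u b (Defs.proj P a b x)).
  apply: (@L2_mul_bounded _ _ _ 1) => //.
  - exact: (measurableT_comp (mi _ setT m2) (proj_measurable ab)).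
  - by apply: aeW => x _; exact: indic_le1.
  - exact: ntrace_L2_opposite.
have := integrableD mS (integrable_mul mS Lu (ntrace_L2_contact ab Vv))
                       (integrable_mul mS Lu' (ntrace_L2_opposite ab Vv)).
apply: eq_integrable => // x _ /=; congr EFin; rewrite /xdensity; ring.
Qed.

Lemma Xform_linear c u v w : V0 dS P u -> V0 dS P v -> V0 dS P w ->
  Xform dS P ori theta S1 (c *: u + v) w =
  c * Xform dS P ori theta S1 u w + Xform dS P ori theta S1 v w.
Proof.
move=> Vu Vv Vw; rewrite /Xform [X in _ = X + _]mulrCA -[RHS]mulrDr; congr (_ * _).
rewrite mulr_sumr -big_split; apply: eq_bigr => q /hori[].
case: (ori q) => a b /= ab _.
have Vuv := V0_linear hgeo c Vu Vv.
apply: Rintegral_ae_linear.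
- exact: S_measurable.
- exact: xdensity_integrable.
- exact: xdensity_integrable.
- by have /integrableP[/measurable_EFinP] := xdensity_integrable ab Vuv Vw.
- apply: filterS2 (ntrace_linear_contact c ab Vu Vv)
                  (ntrace_linear_opposite c ab Vu Vv) => x ux uy Sx.
  by rewrite (ux Sx) (uy Sx); ring.
Qed.

Lemma Xform_sym u v :
  Xform dS P ori theta S1 u v = Xform dS P ori theta S1 v u.
Proof.
congr (_ * _); apply: eq_bigr => q _; case: (ori q) => a b.
by apply: eq_Rintegral => x _; ring.
Qed.

Lemma Xform_ge0 u : 0 <= Xform dS P ori theta S1 u u.
Proof.
rewrite mulr_ge0 ?theta_inv_ge0//; apply: sumr_ge0 => q _; case: (ori q) => a b.
apply: Rintegral_ge0 => x _.
by rewrite addr_ge0// mulr_ge0 -?expr2 ?sqr_ge0// indicE.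
Qed.

End subareas.

(** Monotonicity of the negative part, in the form required by the integrand. *)
Lemma min0_mul_mono (y t : R) : Num.min 0 (y - t) * t <= Num.min 0 y * t.
Proof. by case: (leP 0 (y - t)); case: (leP 0 y); nra. Qed.

Lemma min0_L2 E f : measurable E -> L2 dS E f -> L2 dS E (fun x => Num.min 0 (f x)).
Proof.
move=> mE Lf; apply: L2_dominated (Lf) => //.
- by apply: measurable_minr => //; case: Lf.
- apply: aeW => x _; by have [f0|f0] := leP 0 (f x); rewrite ?normr0.
Qed.

Lemma interpenetration_L2 a b u : contact_gap dS P -> b \in nbr P a -> V0 dS P u ->
  L2 dS (S P a b) (fun x =>
    gap P a b x - ntrace P u a x - ntrace P u b (Defs.proj P a b x)).
Proof.
move=> hgap ab Vu; have mS := S_measurable ab.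
have LN f : L2 dS (S P a b) f -> L2 dS (S P a b) (fun x => - f x).
  by move=> Lf; under eq_fun do rewrite -mulN1r; exact: L2Z.
apply: L2D => //; [apply: L2D => //|].
- have [[/H12_L2 Lg _] _] := hgap a b ab.
  by apply: L2_subset (S_sub ab) Lg => //; exact: Gamma_measurable.
- exact/LN/ntrace_L2_contact.
- exact/LN/ntrace_L2_opposite.
Qed.

(** The direction w lowers the distance y between the bodies by its normal jump
    t, and the penalty term of every contact pair is pointwise monotone along
    it. *)
Lemma Jform_monotone u w : contact_gap dS P -> V0 dS P u -> V0 dS P w ->
  0 <= Jform dS P ori theta (u + w) w - Jform dS P ori theta u w.
Proof.
move=> hgap Vu Vw; have Vuw := V0D hgeo Vu Vw.
rewrite /Jform -mulrBr mulNr -mulrN opprB mulr_ge0 ?theta_inv_ge0//.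
rewrite subr_ge0; apply: ler_sum => q /hori[]; case: (ori q) => a b /= ab _.
have mS := S_measurable ab.
pose t x := ntrace P w a x + ntrace P w b (Defs.proj P a b x).
have Lt : L2 dS (S P a b) t.
  by apply: L2D => //; [exact: ntrace_L2_contact|exact: ntrace_L2_opposite].
pose y x := gap P a b x - ntrace P u a x - ntrace P u b (Defs.proj P a b x).
have Ly : L2 dS (S P a b) y by exact: interpenetration_L2.
have Lyt : L2 dS (S P a b) (fun x => y x - t x).
  by apply: L2D => //; under eq_fun do rewrite -mulN1r; exact: L2Z.
have Iyt := integrable_mul mS (min0_L2 mS Lyt) Lt.
have Iuw := integrable_mul mS (min0_L2 mS (interpenetration_L2 hgap ab Vuw)) Lt.
apply: (@le_trans _ _ (\int[dS]_(x in S P a b) (Num.min 0 (y x - t x) * t x))).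
  rewrite le_eqVlt; apply/orP; left; apply/eqP; apply: ae_eq_Rintegral => //.
  - by have /integrableP[/measurable_EFinP] := Iuw.
  - by have /integrableP[/measurable_EFinP] := Iyt.
  apply: filterS2 (ntrace_linear_contact 1 ab Vu Vw)
                  (ntrace_linear_opposite 1 ab Vu Vw) => x ux uy Sx.
  move: (ux Sx) (uy Sx); rewrite displacement_add1E !mul1r /= => -> ->.
  by congr (Num.min 0 _ * _); rewrite /y /t; ring.
apply: le_Rintegral => //; first exact: integrable_mul (min0_L2 mS Ly) Lt.
by move=> x _; exact: min0_mul_mono.
Qed.

End penalty.
End contact_surface.

(** * Contraction in the norm of the preconditioner *)

Section energy_contraction.
Context {R : realType} {V : lmodType R} (K : set V) (G : V -> V -> R) (n : V -> R).
Context (B C L : R) (hB : 0 < B) (hC : 0 < C) (hL : 0 < L).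
Context (Ksub : forall u v, K u -> K v -> K (u - v)).
Context (Glin : forall c u v w, K u -> K v -> K w ->
  G (c *: u + v) w = c * G u w + G v w).
Context (Gsym : forall u v, K u -> K v -> G u v = G v u).
Context (n_ge0 : forall u, 0 <= n u).
Context (Gcoercive : forall u, K u -> B * n u ^+ 2 <= G u u).
Context (Gbounded : forall u, K u -> G u u <= C * n u ^+ 2).

Lemma form_sqrB u v : K u -> K v -> G (u - v) (u - v) = G u u - 2 * G u v + G v v.
Proof.
move=> Ku Kv; have Kuv := Ksub Ku Kv.
have GB w : K w -> G (u - v) w = G u w - G v w.
  by move=> Kw; rewrite addrC -scaleN1r Glin//; ring.
rewrite GB// (Gsym Ku Kuv) (Gsym Kv Kuv) !GB// (Gsym Kv Ku); ring.
Qed.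

(** F stands for the residual difference and need not be linear: only its value
    at e and its size at e' - e matter. *)
Lemma energy_step (gamma : R) (F : V -> R) e e' : 0 < gamma -> K e -> K e' ->
  (forall v, K v -> G e' v = G e v - gamma * F v) ->
  B * n e ^+ 2 <= F e ->
  (forall v, K v -> `|F v| <= L * n e * n v) ->
  G e' e' <= G e e - gamma * (2 * B - gamma * L ^+ 2 / B) * n e ^+ 2.
Proof.
move=> g0 Ke Ke' step Fe Fbnd.
pose g := e' - e; have Kg : K g by exact: Ksub.
have Gg v : K v -> G g v = - gamma * F v.
  move=> Kv; rewrite /g addrC -scaleN1r Glin// step//; ring.
have expand : G e' e' = G e e - 2 * gamma * F e + G g g.
  have := form_sqrB Ke' Ke; rewrite -/g => ->.
  have -> : G e' e = G e e - gamma * F e by exact: step.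
  ring.
pose p := gamma * L * n e.
have p0 : 0 <= p by rewrite !mulr_ge0// ltW.
have Ggp : G g g <= p * n g.
  rewrite Gg// mulNr -mulrN /p -!mulrA ler_pM2l// mulrA.
  by rewrite (le_trans _ (Fbnd g Kg))// -normrN ler_norm.
have Ggg : G g g <= p ^+ 2 / B.
  have Bp : B * n g ^+ 2 <= p * n g by exact: le_trans (Gcoercive Kg) Ggp.
  have [ng0|ngn0] := eqVneq (n g) 0.
    by rewrite (le_trans Ggp)// ng0 mulr0 divr_ge0 ?sqr_ge0// ltW.
  have ng_gt0 : 0 < n g by rewrite lt_def ngn0 n_ge0.
  have Bg : B * n g <= p by move: Bp; rewrite expr2 mulrA ler_pM2r.
  rewrite (le_trans Ggp)// ler_pdivlMr// expr2 -mulrA ler_wpM2l//.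
  by rewrite mulrC.
(* p bounds B |g|, which is where the term p^2 / B comes from. *)
rewrite expand; have -> : gamma * (2 * B - gamma * L ^+ 2 / B) * n e ^+ 2 =
    2 * gamma * (B * n e ^+ 2) - p ^+ 2 / B.
  by rewrite /p; field; rewrite gt_eqF.
have : 2 * gamma * (B * n e ^+ 2) <= 2 * gamma * F e by rewrite ler_pM2l// mulr_gt0.
by move: Ggg; lra.
Qed.

Definition contraction_factor (gamma : R) : R :=
  1 - gamma * (2 * B - gamma * L ^+ 2 / B) / C.

Lemma relaxation_gain_gt0 gamma : 0 < gamma < 2 * B ^+ 2 / L ^+ 2 ->
  0 < gamma * (2 * B - gamma * L ^+ 2 / B).
Proof.
move=> /andP[g0 gL]; rewrite mulr_gt0// subr_gt0 ltr_pdivrMr//.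
have -> : 2 * B * B = 2 * B ^+ 2 by rewrite expr2 mulrA.
by rewrite -ltr_pdivlMr ?exprn_gt0.
Qed.

Lemma energy_contraction (gamma : R) (F : V -> R) e e' :
  0 < gamma < 2 * B ^+ 2 / L ^+ 2 -> K e -> K e' ->
  (forall v, K v -> G e' v = G e v - gamma * F v) ->
  B * n e ^+ 2 <= F e ->
  (forall v, K v -> `|F v| <= L * n e * n v) ->
  G e' e' <= contraction_factor gamma * G e e.
Proof.
move=> g02 Ke Ke' step Fe Fbnd; have /andP[g0 _] := g02.
apply: (le_trans (energy_step g0 Ke Ke' step Fe Fbnd)).
have kappa := relaxation_gain_gt0 g02.
set k := gamma * _ in kappa *.
rewrite /contraction_factor -/k mulrBl mul1r lerB// mulrAC -mulrA ler_pM2l//.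
by rewrite ler_pdivrMr// mulrC; exact: Gbounded.
Qed.

End energy_contraction.

(** * Rates *)

Section rates.
Context {R : realType}.
Implicit Types (x c : R).

(** No sign is assumed for c: if c < 0, then x <= 0 and its square root
    vanishes.  This covers the trivial space, on which nothing forces B <= M. *)
Lemma sqrt_contraction x y c : 0 <= y -> x <= c * y ->
  Num.sqrt x <= Num.sqrt c * Num.sqrt y.
Proof.
move=> y0 xcy; have [c0|c0] := leP 0 c.
  by rewrite -sqrtrM// ler_wsqrtr.
rewrite ler0_sqrtr ?mulr_ge0 ?sqrtr_ge0//.
by rewrite (le_trans xcy)// mulr_le0_ge0// ltW.
Qed.

Lemma cvg0_linear_rate (E n : nat -> R) (q B : R) : 0 < B -> 0 <= q < 1 ->
  (forall k, 0 <= n k) -> (forall k, B * n k ^+ 2 <= E k ^+ 2) ->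
  (forall k, 0 <= E k) -> (forall k, E k.+1 <= q * E k) ->
  n k @[k --> \oo] --> (0 : R).
Proof.
move=> B0 /andP[q0 q1] n0 nE E0 Eq.
have Ek k : E k <= geometric (E 0%N) q k.
  elim: k => [|k IH]; first by rewrite /geometric/= expr0 mulr1.
  rewrite (le_trans (Eq k))//= exprS mulrCA ler_wpM2l//.
have nk k : n k <= geometric ((Num.sqrt B)^-1 * E 0%N) q k.
  rewrite /geometric/= -mulrA ler_pdivlMl ?sqrtr_gt0//.
  rewrite (le_trans _ (Ek k))// -(ler_pXn2r (n := 2)) ?nnegrE// ?mulr_ge0 ?sqrtr_ge0//.
  by rewrite exprMn sqr_sqrtr ?(ltW B0)//.
apply: (@squeeze_cvgr _ _ _ _ (cst 0) (geometric ((Num.sqrt B)^-1 * E 0%N) q)).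
- by near=> k; rewrite /cst n0 nk.
- exact: cvg_cst.
- by apply: cvg_geometric; rewrite ger0_norm.
Unshelve. all: by end_near.
Qed.

Lemma rate_lt1 (M B D Z gamma : R) : 0 < M -> 0 < B -> 0 < D -> 0 < Z ->
  0 < gamma < 2 * B ^+ 2 / (M + D) ^+ 2 -> rate M B D Z gamma < 1.
Proof.
move=> M0 B0 D0 Z0 g; rewrite /rate -[ltRHS]sqrtr1 ltr_sqrt//.
rewrite ltrBlDr ltrDl divr_gt0 ?addr_gt0//.
by apply: relaxation_gain_gt0 => //; exact: addr_gt0.
Qed.

(** Completing the square: the gain gamma (2 B - gamma L^2 / B), with L = M + D,
    falls short of its maximum B^3 / L^2 by (B^2 / L - gamma L)^2 / B. *)
Lemma rate_min (M B D Z gamma : R) : 0 < M -> 0 < B -> 0 < D -> 0 < Z ->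
  rate M B D Z (B ^+ 2 / (M + D) ^+ 2) <= rate M B D Z gamma.
Proof.
move=> M0 B0 D0 Z0; apply: ler_wsqrtr; rewrite lerB// ler_pM2r ?invr_gt0 ?addr_gt0//.
set L := M + D; have L0 : 0 < L by exact: addr_gt0.
rewrite -subr_ge0.
have -> : B ^+ 2 / L ^+ 2 * (2 * B - B ^+ 2 / L ^+ 2 * L ^+ 2 / B) -
    gamma * (2 * B - gamma * L ^+ 2 / B) = (B ^+ 2 / L - gamma * L) ^+ 2 / B.
  by field; rewrite !gt_eqF.
by rewrite divr_ge0 ?sqr_ge0// ltW.
Qed.

End rates.

(** * The iterative method *)

Section relaxed_iteration.
Context {R : realType} {V : lmodType R} (K : set V).
Context (A X J : V -> V -> R) (L n : V -> R).
Context (Klin : forall c u v, K u -> K v -> K (c *: u + v)).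
Context (Alin : forall c u v w, K u -> K v -> K w ->
  A (c *: u + v) w = c * A u w + A v w).
Context (Asym : forall u v, K u -> K v -> A u v = A v u).
Context (Xlin : forall c u v w, K u -> K v -> K w ->
  X (c *: u + v) w = c * X u w + X v w).
Context (Xsym : forall u v, X u v = X v u).
Implicit Types (u v w : V) (gamma : R).

Let G u v := A u v + X u v.

Lemma closed_sub u v : K u -> K v -> K (u - v).
Proof. by move=> Ku Kv; rewrite addrC -scaleN1r; exact: Klin. Qed.

Lemma closed_comb c d u v : K u -> K v -> K (c *: u + d *: v).
Proof.
move=> Ku Kv; apply: Klin => //; rewrite -[d *: v]addr0.
by apply: Klin => //; rewrite -(subrr v); exact: closed_sub.
Qed.

Lemma sum_form_linear c u v w : K u -> K v -> K w ->
  G (c *: u + v) w = c * G u w + G v w.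
Proof. by move=> Ku Kv Kw; rewrite /G Alin// Xlin//; ring. Qed.

Lemma sum_form_sym u v : K u -> K v -> G u v = G v u.
Proof. by move=> Ku Kv; rewrite /G Asym// Xsym. Qed.

Lemma sum_formB u v w : K u -> K v -> K w -> G (u - v) w = G u w - G v w.
Proof.
by move=> Ku Kv Kw; rewrite addrC -scaleN1r sum_form_linear//; ring.
Qed.

Lemma sum_form_comb c d u v w : K u -> K v -> K w ->
  G (c *: u + d *: v) w = c * G u w + d * G v w.
Proof.
move=> Ku Kv Kw; have K0 : K (v - v) by exact: closed_sub.
have Kdv : K (d *: v) by rewrite -[d *: v]addr0 -(subrr v); exact: Klin.
rewrite sum_form_linear//; congr (_ + _).
by rewrite -[d *: v]addr0 -{1}(subrr v) sum_form_linear// sum_formB//; ring.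
Qed.

(** The two forms of the method, over an abstract module: the relaxed step through
    an auxiliary iterate, and the equation for the increment. *)
Definition two_step gamma (u ut : nat -> V) : Prop :=
  forall k, [/\ K (ut k.+1),
    (forall v, K v -> A (ut k.+1) v + X (ut k.+1) v = L v + X (u k) v - J (u k) v) &
    u k.+1 = gamma *: ut k.+1 + (1 - gamma) *: u k].

Definition residual_step gamma u u' : Prop :=
  forall v, K v -> G u' v = G u v - gamma * (A u v + J u v - L v).

Lemma two_step_closed gamma (u ut : nat -> V) : K (u 0%N) ->
  two_step gamma u ut -> forall k, K (u k).
Proof.
by move=> K0 hut; elim=> // k Kk; have [Kut _ ->] := hut k; exact: closed_comb.
Qed.

(** Solving the relaxation formula for the auxiliary iterate determines it, and
    linearity of G exchanges the two equations. *)
Lemma two_step_residual gamma (u : nat -> V) : gamma != 0 -> (forall k, K (u k)) ->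
  (exists ut, two_step gamma u ut) <-> forall k, residual_step gamma (u k) (u k.+1).
Proof.
move=> g0 Ku; split.
  move=> [ut hut] k v Kv; have [Kut eqt ->] := hut k.
  rewrite sum_form_comb//.
  have -> : G (ut k.+1) v = L v + X (u k) v - J (u k) v by exact: eqt.
  by rewrite /G; ring.
move=> hG; pose ut k := if k is k'.+1 then gamma^-1 *: (u k - u k') + u k' else u k.
exists ut => k; have Kd : K (u k.+1 - u k) by exact: closed_sub.
split.
- exact: Klin.
- move=> v Kv; rewrite -[LHS]/(G (gamma^-1 *: (u k.+1 - u k) + u k) v).
  by rewrite sum_form_linear// sum_formB// (hG k v Kv) /G; field.
- rewrite /ut scalerDr scalerA divff// scale1r scalerBl scale1r.
  by rewrite addrACA subrr addr0 subrK.
Qed.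

Context (M B D Z : R) (hM : 0 < M) (hB : 0 < B) (hD : 0 < D) (hZ : 0 < Z).
Context (n_ge0 : forall u, 0 <= n u).
Context (hAM : forall u v, K u -> K v -> `|A u v| <= M * n u * n v).
Context (hAB : forall u, K u -> B * n u ^+ 2 <= A u u).
Context (hJD : forall u v w, K u -> K v -> K w ->
   `|J (u + w) v - J u v| <= D * n v * n w).
Context (J_mono : forall u w, K u -> K w -> 0 <= J (u + w) w - J u w).
Context (hXZ : forall u v, K u -> K v -> `|X u v| <= Z * n u * n v).
Context (X_ge0 : forall u, 0 <= X u u).

Lemma sum_form_coercive u : K u -> B * n u ^+ 2 <= G u u.
Proof. by move=> Ku; rewrite (le_trans (hAB Ku))// lerDl. Qed.

Lemma sum_form_bounded u : K u -> G u u <= (M + Z) * n u ^+ 2.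
Proof.
move=> Ku; rewrite mulrDl expr2 !mulrA lerD//.
- by rewrite (le_trans (ler_norm _))// hAM.
- by rewrite (le_trans (ler_norm _))// hXZ.
Qed.

Lemma sum_form_ge0 u : K u -> 0 <= G u u.
Proof.
by move=> /sum_form_coercive; apply: le_trans; rewrite mulr_ge0 ?sqr_ge0// ltW.
Qed.

(** The residual at ubar vanishes, so the step is one of [energy_contraction] with
    F the difference of the residuals at u and ubar: coercive by monotonicity of
    J, and Lipschitz with constant M + D. *)
Lemma residual_step_contraction gamma ubar u u' :
  0 < gamma < 2 * B ^+ 2 / (M + D) ^+ 2 ->
  K ubar -> (forall v, K v -> A ubar v + J ubar v - L v = 0) -> K u -> K u' ->
  residual_step gamma u u' ->
  Num.sqrt (G (u' - ubar) (u' - ubar))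
    <= rate M B D Z gamma * Num.sqrt (G (u - ubar) (u - ubar)).
Proof.
move=> hg Kb hsol Ku Ku' step.
have Ke := closed_sub Ku Kb; have Ke' := closed_sub Ku' Kb.
pose e := u - ubar.
pose F v := A e v + (J (ubar + e) v - J ubar v).
have AB v : K v -> A e v = A u v - A ubar v.
  by move=> Kv; rewrite /e addrC -scaleN1r Alin//; ring.
apply: sqrt_contraction; first exact: sum_form_ge0.
apply: (energy_contraction hB (addr_gt0 hM hZ) (addr_gt0 hM hD) closed_sub
  sum_form_linear sum_form_sym n_ge0 sum_form_coercive sum_form_bounded
  (F := F)) => //.
- move=> v Kv; rewrite !sum_formB// step// /F AB//.
  rewrite /e [ubar + _]addrC subrK; have := hsol v Kv.
  by move=> /eqP; rewrite subr_eq0 => /eqP <-; ring.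
- rewrite /F (le_trans (hAB Ke))// lerDl.
  exact: J_mono.
- move=> v Kv; rewrite /F (le_trans (ler_normD _ _))// mulrDl mulrDl lerD// ?hAM//.
  by rewrite mulrAC hJD.
Qed.

Lemma residual_steps_cvg gamma ubar (u : nat -> V) :
  0 < gamma < 2 * B ^+ 2 / (M + D) ^+ 2 ->
  K ubar -> (forall v, K v -> A ubar v + J ubar v - L v = 0) -> (forall k, K (u k)) ->
  (forall k, residual_step gamma (u k) (u k.+1)) ->
  n (u k - ubar) @[k --> \oo] --> (0 : R).
Proof.
move=> hg Kb hsol Ku step.
apply: (cvg0_linear_rate
  (E := fun k => Num.sqrt (G (u k - ubar) (u k - ubar)))
  (q := rate M B D Z gamma) hB) => //.
- by rewrite sqrtr_ge0 rate_lt1.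
- move=> k; have Ke := closed_sub (Ku k) Kb.
  by rewrite sqr_sqrtr; [exact: sum_form_coercive|exact: sum_form_ge0].
- by move=> k; exact: residual_step_contraction.
Qed.

End relaxed_iteration.

Theorem theorem6 (R : realType) (N : nat)
    (dS : {measure set (R3 R) -> \bar R}) (hdS : is_surface_measure dS)
    (P : contact_problem R N)
    (hgeo : contact_geometry dS P)
    (hloads : contact_loads dS P)
    (helast : elasticity_tensor P)
    (b d : R) (hbd : 0 < b <= d) (hell : uniformly_elliptic P b d)
    (hgap : contact_gap dS P)
    (ori : {set 'I_N} -> 'I_N * 'I_N) (hori : orientation P ori)
    (S1 : 'I_N -> 'I_N -> set (R3 R)) (hS1 : contact_subareas P S1)
    (theta : R) (htheta : 0 < theta)
    (M B D Z : R) (hM : 0 < M) (hB : 0 < B) (hD : 0 < D) (hZ : 0 < Z)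
    (hAM : forall u v, V0 dS P u -> V0 dS P v ->
       `|Aform P u v| <= M * V0norm P u * V0norm P v)
    (hAB : forall u, V0 dS P u -> B * V0norm P u ^+ 2 <= Aform P u u)
    (hJD : forall u v w, V0 dS P u -> V0 dS P v -> V0 dS P w ->
       `|Jform dS P ori theta (u + w) v - Jform dS P ori theta u v|
         <= D * V0norm P v * V0norm P w)
    (hXZ : forall u v, V0 dS P u -> V0 dS P v ->
       `|Xform dS P ori theta S1 u v| <= Z * V0norm P u * V0norm P v)
    (gamma : R) (hgamma : 0 < gamma < 2 * B ^+ 2 / (M + D) ^+ 2)
    (ubar : displacement R N) (hubar : V0 dS P ubar)
    (hsol : forall v, V0 dS P v ->
       Aform P ubar v + Jform dS P ori theta ubar v - Lform dS P v = 0) :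
  (* equivalence of the two forms of the iterative method *)
  (forall u : nat -> displacement R N, (forall k, V0 dS P (u k)) ->
     (exists ut, two_step_iteration dS P ori theta S1 gamma u ut) <->
     G_iteration dS P ori theta S1 gamma u) /\
  (* strong convergence and linear rate in the G-norm *)
  (forall u ut : nat -> displacement R N, V0 dS P (u 0%N) ->
     two_step_iteration dS P ori theta S1 gamma u ut ->
     (forall k, V0 dS P (u k)) /\
     (V0norm P (u k - ubar) @[k --> \oo] --> (0 : R)) /\
     (forall k, Gnorm dS P ori theta S1 (u k.+1 - ubar)
                  <= rate M B D Z gamma * Gnorm dS P ori theta S1 (u k - ubar))) /\
  rate M B D Z gamma < 1 /\
  (* the minimal q over the admissible range is attained at B^2 / M_*^2 *)
  0 < B ^+ 2 / (M + D) ^+ 2 < 2 * B ^+ 2 / (M + D) ^+ 2 /\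
  (forall gamma', 0 < gamma' < 2 * B ^+ 2 / (M + D) ^+ 2 ->
     rate M B D Z (B ^+ 2 / (M + D) ^+ 2) <= rate M B D Z gamma').
Proof.
have /andP[g0 _] := hgamma.
pose V := displacement_lmod R N.
pose K : set V := V0 dS P.
pose A : V -> V -> R := Aform P.
pose X : V -> V -> R := Xform dS P ori theta S1.
pose J : V -> V -> R := Jform dS P ori theta.
pose L : V -> R := Lform dS P.
pose n : V -> R := V0norm P.
have Klin (c : R) (u v : V) : K u -> K v -> K (c *: u + v).
  by move=> Ku Kv; rewrite /K -displacement_linearE; exact: (V0_linear hgeo).
have Alin (c : R) (u v w : V) : K u -> K v -> K w ->
    A (c *: u + v) w = c * A u w + A v w.
  move=> Ku Kv Kw; rewrite /A -displacement_linearE.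
  exact: (Aform_linear hgeo helast).
have Asym (u v : V) : K u -> K v -> A u v = A v u by exact: (Aform_sym hgeo helast).
have Xlin (c : R) (u v w : V) : K u -> K v -> K w ->
    X (c *: u + v) w = c * X u w + X v w.
  move=> Ku Kv Kw; rewrite /X -displacement_linearE.
  exact: (Xform_linear hgeo hori theta hS1).
have Xsym (u v : V) : X u v = X v u by exact: Xform_sym.
have Xge0 (u : V) : 0 <= X u u by exact: Xform_ge0.
have n_ge0 (u : V) : 0 <= n u by exact: sqrtr_ge0.
have JD (u v w : V) : K u -> K v -> K w ->
    `|J (u + w) v - J u v| <= D * n v * n w.
  by move=> Ku Kv Kw; rewrite /J -displacement_addE; exact: hJD.
have Jmono (u w : V) : K u -> K w -> 0 <= J (u + w) w - J u w.
  move=> Ku Kw; rewrite /J -displacement_addE.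
  exact: (Jform_monotone hgeo hori htheta hgap).
have two_stepE (u ut : nat -> V) : two_step_iteration dS P ori theta S1 gamma u ut <->
    two_step K A X J L gamma u ut.
  by split=> h k; have := h k; rewrite displacement_combE.
split.
  move=> u Ku.
  have equiv := two_step_residual J L Klin Alin Xlin (lt0r_neq0 g0) Ku.
  apply: (iff_trans _ equiv).
  by split=> -[ut /two_stepE]; exists ut.
split; last first.
  split; first exact: rate_lt1.
  split; last by move=> gamma' _; exact: rate_min.
  have s0 : 0 < B ^+ 2 / (M + D) ^+ 2 by rewrite divr_gt0 ?exprn_gt0 ?addr_gt0.
  by rewrite s0 -mulrA mulr_natl mulr2n ltrDl.
move=> u ut V0u0 /two_stepE hut.
have Ku := two_step_closed Klin V0u0 hut.
split; first exact: Ku.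
have step : forall k, residual_step K A X J L gamma (u k) (u k.+1).
  by apply/(two_step_residual J L Klin Alin Xlin (lt0r_neq0 g0) Ku); exists ut.
split=> [|k].
  under eq_fun do rewrite displacement_subE.
  exact: (residual_steps_cvg Klin Alin Asym Xlin Xsym hM hB hD hZ n_ge0
    hAM hAB JD Jmono hXZ Xge0 hgamma hubar hsol Ku step).
rewrite !displacement_subE.
exact: (residual_step_contraction Klin Alin Asym Xlin Xsym hM hB hD hZ n_ge0
    hAM hAB JD Jmono hXZ Xge0 hgamma hubar hsol (Ku k) (Ku k.+1) (step k)).
Qed.
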